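(* Let $\epsilon>0$ and let $k$ be a positive integer. There is a constant $C$ depending only on $k$ and $\epsilon$ such that for all positive integers $n_1,n_2$, $\mathrm{unv}(D_k(n_1,n_2))\le (2^k+\epsilon)(n_1+n_2)+C$.
   Context: For nonnegative integers $n_1,n_2$ and positive integer $k$, $D_k(n_1,n_2)$ is the acyclic digraph obtained from an arcless digraph on a vertex set $V_1\cup V_2$ ($|V_1|=n_1$, $|V_2|=n_2$, disjoint) by adding a set $S$ of $k$ vertices such that every vertex of $V_1$ dominates every vertex of $S$, every vertex of $S$ dominates every vertex of $V_2$, and $S$ induces a transitive tournament. A digraph is $p$-unavoidable if it is contained in (isomorphic to a subdigraph of) every tournament of order $p$; $\mathrm{unv}(D)$ is the least such $p$. *)

(* Defs.v *)
(* MathComp world (with the real numbers of MathComp-Analysis). *)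
From HB Require Import structures.
From mathcomp Require Import all_boot all_order all_algebra.
From mathcomp Require Import reals.

Set Implicit Arguments.
Unset Strict Implicit.
Unset Printing Implicit Defensive.

(* A finite digraph is given by its arc relation on a finType of vertices;
   [d x y] means that x dominates y. *)

Definition tournament (T : finType) (e : rel T) : Prop :=
  irreflexive e /\ forall x y : T, x != y -> e x y (+) e y x.

(* The copy of [d] in [e] need not be induced. *)
Definition contains (T U : finType) (e : rel T) (d : rel U) : Prop :=
  exists f : U -> T, injective f /\ forall x y : U, d x y -> e (f x) (f y).

Definition unavoidable (U : finType) (p : nat) (d : rel U) : Prop :=
  forall (T : finType) (e : rel T), #|T| = p -> tournament e -> contains e d.

(* [is_unv d p] reads unv(d) = p. A relation is used because a digraph with a
   directed cycle is p-unavoidable for no p. *)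
Definition is_unv (U : finType) (d : rel U) (p : nat) : Prop :=
  unavoidable p d /\ forall q : nat, unavoidable q d -> p <= q.

(* The summands of the vertex type are V_1, S and V_2, in this order. *)
Definition Dk_vertex (k n1 n2 : nat) : finType := ('I_n1 + 'I_k + 'I_n2)%type.

Definition Dk (k n1 n2 : nat) : rel (Dk_vertex k n1 n2) := fun x y =>
  match x, y with
  | inl (inl _), inl (inr _) => true
  | inl (inr _), inr _ => true
  | inl (inr i), inl (inr j) => i < j
  | _, _ => false
  end.

(* Main.v *)
(* If a tournament [e] contains no copy of [Dk k n1 n2], every transitive k-set
   has fewer than n1 common in-neighbours or fewer than n2 common
   out-neighbours.  By Ramsey's theorem, every large enough vertex set contains
   a transitive t-set whose k-subsets all fail on the same side, so all but a
   bounded number of vertices are split into such t-sets ("blocks").  Let W be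
   the union of the m blocks failing on the "in" side.  A vertex x of W has, on
   average, about t/2 out-neighbours in a block X, so by convexity the number of
   pairs (x, S) with S a k-subset of a block dominated by x is about
   m |W| C(t/2, k); it is also at most m C(t, k) n1.  Hence |W| is at most about
   2^k n1 for large t, and symmetrically for the "out" side. *)
Require Import Defs.
From HB Require Import structures.
From mathcomp Require Import all_boot all_order all_algebra.
From mathcomp Require Import reals.
From mathcomp Require Import boolp zify lra.

Set Implicit Arguments.
Unset Strict Implicit.
Unset Printing Implicit Defensive.

Import Order.TTheory GRing.Theory Num.Theory.
Local Open Scope ring_scope.

(** * Ramsey's theorem for k-subsets *)

(** Subsets are encoded as subsequences, so that a colour may depend on the order of the vertices,
    as it does for pairs in a tournament. For the step, the [k]-subsequences [v] of the tail are
    coloured by [c (x :: v)], and induction on [a] or [b] is applied inside a homogeneous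
    subsequence. *)
Lemma ramsey_subseq (k a b : nat) : exists N : nat,
  forall (T : eqType) (c : pred (seq T)) (s : seq T), (N <= size s)%N ->
    (exists u, [/\ subseq u s, size u = a &
       forall v, subseq v u -> size v = k -> c v]) \/
    (exists u, [/\ subseq u s, size u = b &
       forall v, subseq v u -> size v = k -> ~~ c v]).
Proof.
elim: k a b => [|k IHk] a b.
  exists (maxn a b) => T c s; rewrite geq_max => /andP[ha hb].
  case: (boolP (c [::])) => hc; [left; exists (take a s) | right; exists (take b s)];
    split=> //; rewrite ?take_subseq ?size_takel //.
  - by move=> v _ /size0nil ->.
  - by move=> v _ /size0nil ->.
elim: a b => [|a IHa] b.
  exists 0%N => T c s _; left; exists [::].
  by split; rewrite ?sub0seq // => -[|y v].
elim: b => [|b [N2 IHb]].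
  exists 0%N => T c s _; right; exists [::].
  by split; rewrite ?sub0seq // => -[|y v].
have [N1 {}IHa] := IHa b.+1.
(* [N1] and [N2] suffice for the target pairs [a, b.+1] and [a.+1, b]; the head [x] supplies the
   missing element. *)
have [N HN] := IHk N1 N2.
exists N.+1 => T c [|x s] // hs.
have extend (d : pred (seq T)) (u : seq T) :
    (forall v, subseq v u -> size v = k.+1 -> d v) ->
    (forall v, subseq v u -> size v = k -> d (x :: v)) ->
    forall v, subseq v (x :: u) -> size v = k.+1 -> d v.
  move=> hu hxu [_ //|y v /=].
  case: eqP => [->|_] hv; last by apply: (hu _ hv).
  by case=> /(hxu _ hv).
have hsx u : subseq u s -> subseq u (x :: s).
  by move=> hu; apply: subseq_trans hu (subseq_cons _ _).
case: (HN T (fun v => c (x :: v)) s hs) => -[u [us su hu]].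
- case: (IHa T c u); first by rewrite su.
  + case=> w [wu sw hw]; left; exists (x :: w); split.
    * by rewrite /= eqxx; apply: subseq_trans wu us.
    * by rewrite /= sw.
    * by apply: extend => // v /subseq_trans/(_ wu); apply: hu.
  + case=> w [wu sw hw]; right; exists w; split=> //.
    exact/hsx/(subseq_trans wu us).
- case: (IHb T c u); first by rewrite su.
  + case=> w [wu sw hw]; left; exists w; split=> //.
    exact/hsx/(subseq_trans wu us).
  + case=> w [wu sw hw]; right; exists (x :: w); split.
    * by rewrite /= eqxx; apply: subseq_trans wu us.
    * by rewrite /= sw.
    * by apply: (extend (predC c)) => // v /subseq_trans/(_ wu); apply: hu.
Qed.

(** * Inequalities for powers and falling factorials *)

(* The tangent line at [a] of the convex map [y ^ k.+1], without subtraction. *)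
Lemma expn_tangent (k a y : nat) :
  (k.+1 * a ^ k * y <= y ^ k.+1 + k * a ^ k.+1)%N.
Proof.
elim: k => [|k IHk]; first by rewrite !mul1n mul0n addn0.
have := leq_mul IHk (leqnn y); rewrite !expnS.
(* The induction hypothesis times [y] bounds [(k+1) a^k y^2]; [2ay <= a^2 + y^2] leads from there to
   the term linear in [y]. *)
have := leq_mul (leqnn (k.+1 * a ^ k)%N) (nat_Cauchy a y).
move: (y ^ k)%N (a ^ k)%N => Y A; lia.
Qed.

Lemma leq_expn_ffact (d k : nat) : ((d - k) ^ k <= d ^_ k)%N.
Proof.
elim: k d => [|k IHk] [|d] //; first by rewrite sub0n exp0n.
rewrite subSS ffactnS expnS /=; apply: leq_mul => //.
by rewrite (leq_trans (leq_subr _ _)).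
Qed.

Lemma ffact_leq_expn (d k : nat) : (d ^_ k <= d ^ k)%N.
Proof.
elim: k d => [|k IHk] d //; rewrite ffactnS expnS leq_mul //.
by apply: leq_trans (IHk _) _; case: k {IHk} => // k; rewrite leq_exp2r ?leq_pred.
Qed.

(** * Double counting over blocks in a tournament *)

(** Common out-neighbours are [common_in] of the reversed relation, so each bound is proved for one
    side only. *)
Definition common_in (T : finType) (e : rel T) (S : {set T}) : {set T} :=
  [set x | [forall y in S, e x y]].

Lemma tournament_flip (T : finType) (e : rel T) :
  tournament e -> tournament (fun x y => e y x).
Proof. by case=> irr tot; split=> [x|x y xy]; [exact: irr|rewrite addbC tot]. Qed.

(** Adding the transposed sum counts each ordered pair of distinct vertices once. *)
Lemma tournament_arcs (T : finType) (e : rel T) (W : {set T}) : tournament e ->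
  (2 * \sum_(x in W) \sum_(y in W) e x y = #|W| * #|W|.-1)%N.
Proof.
move=> [irr tot].
rewrite mul2n -addnn [X in (_ + X)%N]exchange_big /= -big_split /=.
rewrite -sum_nat_const.
apply: eq_bigr => x xW; rewrite -big_split /= (cardsD1 x W) xW /= -sum1_card.
rewrite (big_setD1 x) //= irr add0n; apply: eq_bigr => y.
rewrite !inE => /andP[yx _]; have := tot _ _ yx.
by case: (e x y); case: (e y x).
Qed.

(** Both sides count the pairs of a vertex [x] of [W] and a [k]-subset of [X] dominated by [x]. *)
Lemma sum_bin_common_in (T : finType) (e : rel T) (W X : {set T}) (k : nat) :
  (\sum_(x in W) 'C(#|X :&: [set y | e x y]|, k) =
   \sum_(S : {set T} | (S \subset X) && (#|S| == k)) #|W :&: common_in e S|)%N.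
Proof.
transitivity (\sum_(x in W) \sum_(S : {set T} | (S \subset X) && (#|S| == k))
   (x \in common_in e S))%N.
  apply: eq_bigr => x _; rewrite -cards_draws -sum1_card big_mkcond /=.
  rewrite [RHS]big_mkcond; apply: eq_bigr => S _; rewrite !inE subsetI.
  case: (S \subset X) => //=; case: (#|S| == k); rewrite ?andbF ?andbT //=.
  have -> : (S \subset [set y | e x y]) = [forall y in S, e x y].
    by apply/subsetP/forall_inP => h y /h; rewrite inE.
  by case: [forall _ in _, _].
rewrite exchange_big /=; apply: eq_bigr => S _.
rewrite -sum1_card [RHS]big_mkcond [LHS]big_mkcond; apply: eq_bigr => x _.
by rewrite in_setI; case: (x \in W) => //=; case: (x \in common_in e S).
Qed.

(* The loss from [t] to [t - 2 * k.+1] comes from replacing the falling factorial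
   [d ^_ k] by the smaller [(d - k) ^ k], which is convex, and from the missing
   loops in the arc count. *)
Lemma blocks_cover_bound (T : finType) (e : rel T) (P : {set {set T}})
    (k t n : nat) : tournament e -> trivIset P -> (0 < k)%N ->
  (forall X, X \in P -> #|X| = t) ->
  (forall X S : {set T}, X \in P -> S \subset X -> #|S| = k ->
     (#|common_in e S| <= n)%N) ->
  (#|cover P| * (t - 2 * k.+1) ^ k <= (2 * t) ^ k * n)%N.
Proof.
case: k => // k te tP _ ht hn; set W := cover P; set K := k.+1.
set a := (t - _)%N; pose d x X := #|X :&: [set y | e x y]|.
case: (posnP #|P|) => [/eqP|m0].
  by rewrite cards_eq0 => /eqP P0; rewrite /W P0 /cover big_set0 cards0.
have cW : #|W| = (#|P| * t)%N.
  by move: tP => /eqP <-; rewrite -sum_nat_const; apply: eq_bigr.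
(* With [d = d x X], [(2 (d - K))^K <= 2^K K! C(d, K)]; the double count leaves [C(t, K)] sets with
   at most [n] common in-neighbours each. *)
have upper : (\sum_(X in P) \sum_(x in W) (2 * (d x X - K)) ^ K <=
              #|P| * ((2 * t) ^ K * n))%N.
  rewrite -sum_nat_const; apply: leq_sum => X XP.
  apply: (@leq_trans (\sum_(x in W) 2 ^ K * K`! * 'C(d x X, K))%N).
    apply: leq_sum => x _; rewrite expnMn -mulnA leq_mul2l mulnC bin_ffact.
    by rewrite leq_expn_ffact orbT.
  rewrite -big_distrr /= sum_bin_common_in.
  apply: (@leq_trans (2 ^ K * K`! * ('C(t, K) * n))%N).
    rewrite leq_mul2l; apply/orP; right.
    rewrite -(ht _ XP) -cards_draws -sum_nat_const.
    rewrite big_mkcond [leqRHS]big_mkcond; apply: leq_sum => S _; rewrite inE.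
    case: ifP => // /andP[SX /eqP Sk].
    by apply: leq_trans (subset_leq_card (subsetIr _ _)) (hn X S _ _ _).
  rewrite mulnA -[(2 ^ K * _ * _)%N]mulnA [(K`! * _)%N]mulnC bin_ffact expnMn.
  by rewrite leq_mul // leq_mul // ffact_leq_expn.
have sumd : (2 * \sum_(X in P) \sum_(x in W) d x X = #|W| * #|W|.-1)%N.
  rewrite -(tournament_arcs W te) exchange_big /=; congr (2 * _)%N.
  apply: eq_bigr => x _; rewrite big_trivIset //=; apply: eq_bigr => X _.
  rewrite /d -sum1_card [RHS]big_mkcond [LHS]big_mkcond; apply: eq_bigr => y _.
  by rewrite !inE; case: (y \in X) => //=; case: (e x y).
(* The values [2 (d x X - K)] have mean at least [a] over all pairs; truncated subtraction can only
   raise them. *)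
have sumy : (#|P| * (#|W| * a) <=
             \sum_(X in P) \sum_(x in W) 2 * (d x X - K))%N.
  have : (2 * \sum_(X in P) \sum_(x in W) d x X <=
     \sum_(X in P) \sum_(x in W) (2 * (d x X - K) + 2 * K))%N.
    rewrite big_distrr; apply: leq_sum => X _; rewrite big_distrr.
    by apply: leq_sum => x _ /=; lia.
  under [leqRHS]eq_bigr do rewrite big_split /= sum_nat_const.
  rewrite big_split /= sum_nat_const sumd.
  move: (\sum_(X in P) _)%N => s; rewrite /a cW.
  move: #|P| m0 => m; clear; rewrite -/K => m0.
  case: (leqP (2 * K.+1) t) => ht h; last by nia.
  suff : (m * (m * t * (t - 2 * K.+1)) + m * (m * t * (2 * K)) <=
          m * t * (m * t).-1)%N by lia.
  have -> : (m * (m * t * (t - 2 * K.+1)) + m * (m * t * (2 * K)) =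
            m * t * (m * (t - 2)))%N by nia.
  by apply: leq_mul => //; nia.
(* Jensen's inequality: the tangent inequality at [a] is summed over all pairs, and the mean is at
   least [a]. *)
have lower : (#|P| * (#|W| * a ^ K) <=
              \sum_(X in P) \sum_(x in W) (2 * (d x X - K)) ^ K)%N.
  have : (K * a ^ k * \sum_(X in P) \sum_(x in W) 2 * (d x X - K) <=
    \sum_(X in P) \sum_(x in W) ((2 * (d x X - K)) ^ K + k * a ^ K))%N.
    rewrite big_distrr; apply: leq_sum => X _; rewrite big_distrr.
    by apply: leq_sum => x _; apply: expn_tangent.
  under [leqRHS]eq_bigr do rewrite big_split /= sum_nat_const.
  rewrite big_split /= sum_nat_const => h.
  have := leq_mul (leqnn (K * a ^ k)%N) sumy.
  move: h; rewrite /K expnS.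
  move: (\sum_(X in P) _)%N => s; move: (\sum_(X in P) _)%N => s'.
  move: (a ^ k)%N #|P| #|W| => A m w; clear.
  nia.
by rewrite -(leq_pmul2l m0); apply: leq_trans lower upper.
Qed.

(** * Copies of [Dk] and homogeneous blocks *)

Lemma contains_Dk (T : finType) (e : rel T) (k n1 n2 : nat) (u : seq T) :
  tournament e -> (0 < k)%N -> size u = k -> pairwise e u ->
  (n1 <= #|common_in e [set x in u]|)%N ->
  (n2 <= #|common_in (fun x y => e y x) [set x in u]|)%N ->
  contains e (@Dk k n1 n2).
Proof.
move=> [irr tot] k0 su eu.
set A := common_in _ _; set B := common_in _ _ => hA hB.
(* [x0] serves as default for [nth]; moreover a vertex in both [A] and [B] would form a loop or a
   2-cycle with it. *)
have [x0 x0u] : exists x0, x0 \in u.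
  by case: u su {eu A B hA hB} k0 => [<-|x u] // _ _; exists x; rewrite mem_head.
have uu := pairwise_uniq irr eu.
pose a (i : 'I_n1) := nth x0 (enum A) i.
pose b (i : 'I_n2) := nth x0 (enum B) i.
pose c (i : 'I_k) := nth x0 u i.
have szA (i : 'I_n1) : (i < size (enum A))%N.
  by rewrite -cardE (leq_trans (ltn_ord i) hA).
have szB (i : 'I_n2) : (i < size (enum B))%N.
  by rewrite -cardE (leq_trans (ltn_ord i) hB).
have szu (i : 'I_k) : (i < size u)%N by rewrite su.
have eA i y : y \in u -> e (a i) y.
  have : a i \in A by rewrite -mem_enum mem_nth.
  by rewrite inE => /forall_inP h yu; apply: h; rewrite inE.
have eB i y : y \in u -> e y (b i).
  have : b i \in B by rewrite -mem_enum mem_nth.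
  by rewrite inE => /forall_inP h yu; apply: h; rewrite inE.
have cu i : c i \in u by apply: mem_nth.
have ac i j : a i <> c j.
  by move=> h; have := eA i _ (cu j); rewrite h irr.
have bc i j : b i <> c j.
  by move=> h; have := eB i _ (cu j); rewrite h irr.
have ab i j : a i <> b j.
  move=> h; have := eA i _ x0u; have := eB j _ x0u; rewrite -h => h1 h2.
  have := tot (a i) x0; rewrite h1 h2 /=; case: eqP => [h3|_ /(_ isT)//].
  by rewrite h3 irr in h1.
have inj_nth (n : nat) (s : seq T) (i j : 'I_n) : uniq s ->
    (i < size s)%N -> (j < size s)%N -> nth x0 s i = nth x0 s j -> i = j.
  by move=> us hi hj /eqP; rewrite nth_uniq // => /eqP /val_inj.
exists (fun v => match v with
  | inl (inl i) => a i | inl (inr i) => c i | inr i => b i end); split.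
- move=> [[i|i]|i] [[j|j]|j] h.
  + by rewrite (@inj_nth _ (enum A) i j) ?enum_uniq.
  + by case: (ac _ _ h).
  + by case: (ab _ _ h).
  + by case: (ac _ _ (esym h)).
  + by rewrite (@inj_nth _ u i j).
  + by case: (bc _ _ (esym h)).
  + by case: (ab _ _ (esym h)).
  + by case: (bc _ _ h).
  + by rewrite (@inj_nth _ (enum B) i j) ?enum_uniq.
- move=> [[i|i]|i] [[j|j]|j] //= h; [exact: eA| |exact: eB].
  by have /(pairwiseP x0)/(_ i j (szu i) (szu j) h) := eu.
Qed.

Lemma pairwise_subseq2 (T : eqType) (r : rel T) (s : seq T) :
  (forall x y, subseq [:: x; y] s -> r x y) -> pairwise r s.
Proof.
elim: s => //= x s IHs h; apply/andP; split.
  by apply/allP => y ys; apply: h; rewrite eqxx sub1seq.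
apply: IHs => y z yz; apply: h; case: ifP => // _.
exact: subseq_trans (subseq_cons _ _) yz.
Qed.

(** Ramsey's theorem for pairs, coloured by whether the earlier vertex of an enumeration dominates
    the later one; in the other colour the order is reversed. *)
Lemma transitive_subtournament (n : nat) : exists N : nat,
  forall (T : finType) (e : rel T) (A : {set T}), tournament e ->
    (N <= #|A|)%N ->
    exists w, [/\ size w = n, {subset w <= A} & pairwise e w].
Proof.
have [N HN] := ramsey_subseq 2 n n.
exists N => T e A [irr tot] hA.
pose c (v : seq T) := if v is [:: x; y] then e x y else true.
have [|[u [us su hu]]|[u [us su hu]]] := HN T c (enum A).
- by rewrite -cardE.
- exists u; split=> // [x xu|].
    by rewrite -mem_enum (mem_subseq us).
  by apply: pairwise_subseq2 => x y /hu; apply.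
- exists (rev u); split=> [|x|].
  + by rewrite size_rev.
  + by rewrite mem_rev -mem_enum => /(mem_subseq us).
  + apply: pairwise_subseq2 => x y; rewrite -[[:: x; y]]/(rev [:: y; x]).
    rewrite subseq_rev => h; have := hu _ h erefl; rewrite /c => nyx.
    have : uniq [:: y; x] by apply: subseq_uniq h (subseq_uniq us (enum_uniq _)).
    by rewrite /= inE andbT => /tot; rewrite (negbTE nyx).
Qed.

Definition small_common_in (T : finType) (e : rel T) (k n : nat)
    (X : {set T}) : bool :=
  [forall S : {set T}, (S \subset X) && (#|S| == k) ==>
     (#|common_in e S| < n)%N].

Definition homogeneous_block (T : finType) (e : rel T) (k t n1 n2 : nat)
    (X : {set T}) : bool :=
  (#|X| == t) && (small_common_in e k n1 X ||
                  small_common_in (fun x y => e y x) k n2 X).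

(** Inside a large transitive set, [k]-subsets are coloured by whether they fail on the in side. In
    the other colour the absence of a copy forces failure on the out side. [M] is independent of
    [n1] and [n2], as the final constant must be. *)
Lemma homogeneous_block_exists (k t : nat) : (0 < k)%N -> exists M : nat,
  forall (T : finType) (e : rel T) (n1 n2 : nat) (A : {set T}),
    tournament e -> ~ contains e (@Dk k n1 n2) -> (M <= #|A|)%N ->
    exists2 X : {set T}, X \subset A & homogeneous_block e k t n1 n2 X.
Proof.
move=> k0; have [N HN] := ramsey_subseq k t t.
have [M HM] := transitive_subtournament N.
exists M => T e n1 n2 A te nD hA.
have [w [sw wA ew]] := HM T e A te hA.
have uw := pairwise_uniq te.1 ew.
pose c (v : seq T) := (#|common_in e [set x in v]| < n1)%N.
(* Each [k]-subset of [u] comes from a subsequence obtained by filtering, of size [k] as [u] has no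
   duplicates. *)
have lift (d : pred {set T}) (u : seq T) : subseq u w ->
    (forall v, subseq v u -> size v = k -> d [set x in v]) ->
    forall S : {set T}, (S \subset [set x in u]) && (#|S| == k) -> d S.
  move=> us hd S /andP[Su /eqP Sk].
  have SE : S = [set x in [seq x <- u | x \in S]].
    apply/setP => x; rewrite inE mem_filter andb_idr // => /(subsetP Su).
    by rewrite inE.
  rewrite SE; apply: hd; first exact: filter_subseq.
  rewrite -Sk {2}SE cardsE; apply/esym/card_uniqP.
  exact/filter_uniq/(subseq_uniq us uw).
have block u : subseq u w -> size u = t ->
    [set x in u] \subset A /\ #|[set x in u]| == t.
  move=> us <-; split.
    by apply/subsetP => x; rewrite inE => /(mem_subseq us)/wA.
  by rewrite cardsE; apply/eqP/card_uniqP/(subseq_uniq us uw).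
have [|[u [us su hu]]|[u [us su hu]]] := HN T c w; first by rewrite sw.
- have [uA ut] := block u us su; exists [set x in u] => //.
  rewrite /homogeneous_block ut /=; apply/orP; left.
  by apply/forall_inP; apply: (lift (fun S => #|common_in e S| < n1)%N u us).
- have [uA ut] := block u us su; exists [set x in u] => //.
  rewrite /homogeneous_block ut /=; apply/orP; right.
  apply/forall_inP.
  apply: (lift (fun S => #|common_in (fun x y => e y x) S| < n2)%N u us).
  move=> v vu sv; rewrite ltnNge; apply/negP => hv; apply: nD.
  apply: (contains_Dk te k0 sv _ _ hv).
  + exact: subseq_pairwise (subseq_trans vu us) ew.
  + by rewrite leqNgt; apply: hu.
Qed.

(** * Packing disjoint blocks *)

(** In an inclusion-maximal family the uncovered part contains no set satisfying [Q], hence has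
    fewer than [M] vertices. *)
Lemma maximal_disjoint_family (T : finType) (Q : pred {set T}) (M : nat) :
  ~~ Q set0 ->
  (forall A : {set T}, (M <= #|A|)%N ->
     exists2 X : {set T}, X \subset A & Q X) ->
  exists P : {set {set T}},
    [/\ trivIset P, forall X, X \in P -> Q X & (#|~: cover P| < M)%N].
Proof.
move=> Q0 hM.
pose F (P : {set {set T}}) := trivIset P && [forall X in P, Q X].
have F0 : F set0.
  apply/andP; split; first by apply/trivIsetP => X Y; rewrite inE.
  by apply/forall_inP => X; rewrite inE.
have [P /maxsetP[/andP[tP /forall_inP QP] maxP] _] := maxset_exists F0.
exists P; split=> //; rewrite ltnNge; apply/negP => /hM[X XP QX].
have dX : {in P, forall Y : {set T}, [disjoint X & Y]}.
  move=> Y YP; rewrite disjoints_subset; apply: subset_trans XP _.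
  by rewrite setCS; apply: bigcup_sup.
(* With the empty set excluded, a set disjoint from all members is not itself a member, so adding
   [X] enlarges [P]. *)
have nP : set0 \notin P by apply: contra Q0; apply: QP.
have [tXP] := trivIsetU1 dX tP nP.
case/negP; rewrite -(maxP (X |: P)) ?setU11 ?subsetUr //.
apply/andP; split=> //; apply/forall_inP => Y.
by rewrite in_setU1 => /predU1P[-> //|]; apply: QP.
Qed.

(** * Choice of the block size and conclusion *)

(** The counting bound has ratio [(2t / (t - q))^k] with [q = 2(k + 1)]; the lower bound on [t]
    brings it down to at most [2^k + eps]. *)
Lemma blocks_cover_bound_real (R : realType) (eps : R) (T : finType)
    (e : rel T) (P : {set {set T}}) (k t n : nat) :
  0 < eps -> (0 < k)%N ->
  (2 ^+ k + eps) * (k * (2 * k.+1))%:R <= eps * t%:R -> (0 < t)%N ->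
  tournament e -> trivIset P ->
  (forall X, X \in P -> #|X| = t) ->
  (forall X, X \in P -> small_common_in e k n X) ->
  #|cover P|%:R <= (2 ^+ k + eps) * n%:R.
Proof.
move=> eps0 k0 ht t0 te tP hPt hPs.
have hb : (#|cover P| * (t - 2 * k.+1) ^ k <= (2 * t) ^ k * n)%N.
  apply: (@blocks_cover_bound _ e) => // X S XP SX /eqP Sk; apply: ltnW.
  by have /forall_inP := hPs _ XP; apply; rewrite SX.
move: (2 * k.+1)%N ht hb => q ht hb.
have B0 : 0 < 2 ^+ k + eps by rewrite addr_gt0 ?exprn_gt0.
have tk0 : 0 < (t%:R : R) ^+ k by rewrite exprn_gt0 ?ltr0n.
(* Bernoulli's inequality, as the tangent at [t] taken at [t - q]: the loss [k q t^(k-1)], times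
   [2^k + eps], is at most [eps t^k]. *)
have bern : 2 ^+ k * t%:R ^+ k <= (2 ^+ k + eps) * (t - q)%:R ^+ k :> R.
  clear hPs; case: k k0 B0 ht hb tk0 => // k _ B0 ht hb tk0.
  have tan : k.+1%:R * t%:R ^+ k * (t - q)%:R <=
             (t - q)%:R ^+ k.+1 + k%:R * t%:R ^+ k.+1 :> R.
    by rewrite -!natrX -!natrM -natrD ler_nat expn_tangent.
  have sub : t%:R - q%:R <= (t - q)%:R :> R.
    by rewrite lerBlDr -natrD ler_nat; lia.
  have : k.+1%:R * t%:R ^+ k * (t%:R - q%:R) <=
         (t - q)%:R ^+ k.+1 + k%:R * t%:R ^+ k.+1 :> R.
    by apply: le_trans tan; rewrite ler_wpM2l // mulr_ge0 // exprn_ge0.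
  rewrite -lerBlDr => /(ler_wpM2l (ltW B0)); apply: le_trans.
  have tk : 0 <= t%:R ^+ k :> R by rewrite exprn_ge0.
  have := ler_wpM2l tk ht; rewrite natrM [t%:R ^+ k.+1]exprSr -natr1.
  by lra.
have : 2 ^+ k * t%:R ^+ k * #|cover P|%:R <=
       (2 ^+ k + eps) * (2 ^+ k * t%:R ^+ k * n%:R) :> R.
  apply: le_trans (ler_wpM2r _ bern) _; first exact: ler0n.
  rewrite -[leLHS]mulrA; apply: ler_wpM2l; first exact: ltW.
  move: hb; rewrite -(ler_nat R) !natrM !natrX natrM exprMn.
  by rewrite mulrC.
by rewrite [leRHS]mulrCA ler_pM2l // mulr_gt0 // exprn_gt0.
Qed.

Theorem theorem30 (R : realType) (eps : R) (heps : 0 < eps)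
    (k : nat) (hk : (0 < k)%N) :
  exists C : R, forall n1 n2 : nat, (0 < n1)%N -> (0 < n2)%N ->
    exists p : nat, is_unv (@Dk k n1 n2) p /\
      p%:R <= (2 ^+ k + eps) * (n1 + n2)%:R + C.
Proof.
set B := 2 ^+ k + eps.
have B0 : 0 < B by rewrite addr_gt0 ?exprn_gt0.
(* [t] depends only on [k] and [eps]; hence so do [M] and the constant. *)
pose t := (Num.truncn (B * (k * (2 * k.+1))%:R / eps)).+1.
have ht : B * (k * (2 * k.+1))%:R <= eps * t%:R.
  by rewrite -ler_pdivrMl // mulrC ltW // truncnS_gt.
have [M HM] := homogeneous_block_exists t hk.
exists (M%:R + 1) => n1 n2 _ _.
(* The least integer above the bound for a tournament without a copy; rounding up costs the [1] in
   the constant. *)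
pose p := (Num.truncn (B * (n1 + n2)%:R + M%:R)).+1.
have pgt : B * (n1 + n2)%:R + M%:R < p%:R :> R by apply: truncnS_gt.
have ple : p%:R <= B * (n1 + n2)%:R + (M%:R + 1).
  rewrite -natr1 addrA lerD2r truncn_le.
  by rewrite addr_ge0 ?mulr_ge0 // ltW.
have unav : unavoidable p (@Dk k n1 n2).
  move=> T e Tp te; have [//|nD] := pselect (contains e (@Dk k n1 n2)).
  have [|A hA|P [tP QP hP]] :=
    @maximal_disjoint_family T (homogeneous_block e k t n1 n2) M.
  - by rewrite /homogeneous_block cards0.
  - exact: HM te nD hA.
  (* Blocks failing on both sides go to [P1]; all others fail on the out side. *)
  pose P1 := [set X in P | small_common_in e k n1 X].
  have b1 : #|cover P1|%:R <= B * n1%:R.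
    apply: (@blocks_cover_bound_real _ _ T e P1 k t) => //.
    + by apply: trivIsetS tP; apply/subsetP => X; rewrite inE => /andP[].
    + by move=> X; rewrite inE => /andP[/QP /andP[/eqP]].
    + by move=> X; rewrite inE => /andP[].
  have b2 : #|cover (P :\: P1)|%:R <= B * n2%:R.
    apply: (@blocks_cover_bound_real _ _ T (fun x y => e y x) (P :\: P1) k t) => //.
    + exact: tournament_flip.
    + exact: trivIsetS (subsetDl _ _) tP.
    + by move=> X; rewrite inE => /andP[_ /QP /andP[/eqP]].
    + move=> X; rewrite !inE => /andP[+ XP]; rewrite XP /= => nX.
      by have /andP[_] := QP _ XP; rewrite (negbTE nX).
  have : (p <= #|cover P1| + #|cover (P :\: P1)| + M)%N.
    rewrite -Tp -(cardsC (cover P)) leq_add ?(ltnW hP) //.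
    apply: leq_trans _ (leq_card_setU _ _); apply: subset_leq_card.
    apply/bigcupsP => X XP; rewrite -bigcup_setU.
    by apply: bigcup_sup; rewrite !inE XP /=; case: small_common_in.
  rewrite -(ler_nat R) !natrD => hp.
  by move: pgt; rewrite natrD mulrDr; lra.
(* The value of unv is the least unavoidable order, which exists and is at most [p] because [p] is
   unavoidable. *)
have ex : exists p, `[< unavoidable p (@Dk k n1 n2) >] by exists p; apply/asboolP.
case: (ex_minnP ex) => p0 /asboolP up0 minp0.
exists p0; split.
  by split=> // q /asboolP; apply: minp0.
apply: le_trans ple; rewrite ler_nat; apply: minp0; exact/asboolP.
Qed.
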